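(* The polytope $\mathcal{P}_9\subset\mathbb{H}^9$ consisting of the points $(x_0,x_1,\dots,x_9)\in\mathbb{H}^9$ satisfying the $10$ inequalities $x_0\ge -x_1-x_2-x_3$ and $x_1\le x_2\le\dots\le x_9\le 0$ is a hyperbolic Coxeter $9$-simplex.
   Context: $\mathbb{R}^{1,n}$ is $\mathbb{R}^{n+1}$ with coordinates $(x_0,\dots,x_n)$ in an orthogonal basis $e_0,\dots,e_n$ for a symmetric bilinear form with $e_0^2=1$ and $e_i^2=-1$ for $i\ge1$. $\mathbb{H}^n=\{v\in\mathbb{R}^{1,n}\mid v^2=1,\ v\cdot e_0>0\}$. Let $\mathscr{L}_n=\{v\in\mathbb{R}^{1,n}\mid v^2\ge0\}$. One identifies $\mathbb{H}^n$ with the projectivization of $\{v^2>0\}$, sets $\partial\mathbb{H}^n=\mathbb{P}(\{v\neq0\mid v^2=0\})$, and $\overline{\mathbb{H}^n}=\mathbb{H}^n\cup\partial\mathbb{H}^n\cong(\mathscr{L}_n\setminus\{0\})/\!\sim$, where $\sim$ is nonzero scalar multiplication. For $u\in\mathbb{R}^{1,n}$ with $u^2=-2$, the closed halfspace with normal vector $u$ is $u^{\ge0}=\{x\in\mathbb{H}^n\mid x\cdot u\ge0\}$, and its hyperplane is $u^\perp=\{x\in\mathbb{H}^n\mid x\cdot u=0\}$. A convex polytope in $\mathbb{H}^n$ is the intersection of a locally finite collection of closed halfspaces (every compact subset of $\mathbb{H}^n$ meets only finitely many of the hyperplanes); the collection is always assumed minimal, i.e. no halfspace contains the intersection of the other ones.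 These are the halfspaces determining the polytope. A polytope has finite volume if its closure in $\overline{\mathbb{H}^n}$ is the convex hull of finitely many points of $\overline{\mathbb{H}^n}$. It is a simplex ($n$-simplex) if it has finite volume and is determined by exactly $n+1$ halfspaces (equivalently, its closure in $\overline{\mathbb{H}^n}$ is the convex hull of $n+1$ points of $\overline{\mathbb{H}^n}$). The angle between halfspaces $u^{\ge0},v^{\ge0}$ ($u^2=v^2=-2$) is the $\theta\in[0,\pi]$ with $u\cdot v=2\cos\theta$ when $|u\cdot v|\le2$; if $|u\cdot v|>2$ they are called divergent. A convex polytope is a Coxeter polytope if any two of its determining halfspaces either form an angle $0$, or form an angle $\pi/m$ for some positive integer $m$, or are divergent. A Coxeter simplex is a simplex that is a Coxeter polytope. *)

(* Defs.v *)
From HB Require Import structures.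
From mathcomp Require Import all_boot all_order all_algebra.
From mathcomp Require Import all_classical all_reals all_analysis.
Set Implicit Arguments.
Unset Strict Implicit.
Unset Printing Implicit Defensive.
Import Order.TTheory GRing.Theory Num.Theory.
Import numFieldNormedType.Exports.

Local Open Scope classical_set_scope.
Local Open Scope ring_scope.
Local Open Scope quotient_scope.

Section Hyperbolic.
Variables (R : realType) (n : nat).
Implicit Types u v w x : 'rV[R]_n.+1.

Definition mdot u v : R :=
  u 0 ord0 * v 0 ord0 - \sum_(i < n) u 0 (lift ord0 i) * v 0 (lift ord0 i).

Definition e0 : 'rV[R]_n.+1 := delta_mx 0 ord0.

Definition hyp : set 'rV[R]_n.+1 := [set v | mdot v v = 1 /\ 0 < mdot v e0].

Definition cone : set 'rV[R]_n.+1 := [set v | 0 <= mdot v v].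

(* The projectivized cone is an actual quotient: [nzcone], as a type, carries
   the topology induced from R^(n+1), and [hbar] the quotient topology. *)
Definition nzcone : set 'rV[R]_n.+1 := cone `\ 0.

Definition proportional (x y : set_type nzcone) : bool :=
  `[< exists2 c : R, c != 0 & \val y = c *: \val x >].

Fact proportional_refl : reflexive proportional.
Proof. by move=> x; apply/asboolP; exists 1; rewrite ?oner_eq0 ?scale1r. Qed.

Fact proportional_sym : symmetric proportional.
Proof.
have imp (x y : set_type nzcone) : proportional x y -> proportional y x.
  move=> /asboolP[c c0 xy]; apply/asboolP; exists c^-1; rewrite ?invr_eq0//.
  by rewrite xy scalerA mulVf// scale1r.
by move=> x y; apply/idP/idP; exact: imp.
Qed.

Fact proportional_trans : transitive proportional.
Proof.
move=> y x z /asboolP[c c0 xy] /asboolP[d d0 yz]; apply/asboolP.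
by exists (d * c); rewrite ?mulf_neq0// yz xy scalerA.
Qed.

Canonical proportional_equiv :=
  EquivRel proportional proportional_refl proportional_sym proportional_trans.

Definition hbar := quotient_topology {eq_quot proportional}.
HB.instance Definition _ := Topological.on hbar.

(* [rep v p]: v is a nonzero vector of the cone, and p = [v]. *)
Definition rep v (p : hbar) : Prop :=
  exists x : set_type nzcone, \val x = v /\ \pi_hbar x = p.

Definition to_hbar (P : set 'rV[R]_n.+1) : set hbar :=
  [set p | exists2 v, P v & rep v p].

(* The segment joining two points of [hbar] is the projection of the linear
   segment joining representatives v, w in the same (future) half of the cone;
   it does not depend on the choice of v and w. *)
Definition hbar_convex (C : set hbar) : Prop :=
  forall (p q r : hbar) v w (t : R),
    C p -> C q -> rep v p -> rep w q -> 0 < mdot v e0 -> 0 < mdot w e0 ->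
    0 <= t <= 1 -> rep (t *: v + (1 - t) *: w) r -> C r.

Definition hbar_hull (S : set hbar) : set hbar :=
  \bigcap_(C in [set C | hbar_convex C /\ S `<=` C]) C.

Definition halfspace u : set 'rV[R]_n.+1 := [set x | hyp x /\ 0 <= mdot x u].

Definition hyperplane u : set 'rV[R]_n.+1 := [set x | hyp x /\ mdot x u = 0].

(* Collections of halfspaces are given by their sets N of normal vectors of
   square -2. *)
Definition halfspaces_inter (N : set 'rV[R]_n.+1) : set 'rV[R]_n.+1 :=
  hyp `&` \bigcap_(u in N) halfspace u.

Definition locally_finite (N : set 'rV[R]_n.+1) : Prop :=
  forall K, compact K -> K `<=` hyp ->
    finite_set ((hyperplane @` N) `&` [set H | K `&` H !=set0]).

Definition minimal (N : set 'rV[R]_n.+1) : Prop :=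
  forall u, N u -> ~ (halfspaces_inter (N `\ u) `<=` halfspace u).

(* P is a convex polytope, and N is the collection of normal vectors of the
   halfspaces determining it. Minimality forces distinct elements of N to
   define distinct halfspaces. *)
Definition polytope_with (N P : set 'rV[R]_n.+1) : Prop :=
  [/\ forall u, N u -> mdot u u = -2, locally_finite N, minimal N
    & P = halfspaces_inter N].

Definition finite_volume (P : set 'rV[R]_n.+1) : Prop :=
  exists2 S : set hbar, finite_set S & closure (to_hbar P) = hbar_hull S.

Definition simplex_with (N P : set 'rV[R]_n.+1) : Prop :=
  [/\ polytope_with N P, finite_volume P & (N #= `I_n.+1)%card].

Definition has_angle u v (theta : R) : Prop :=
  [/\ `|mdot u v| <= 2, 0 <= theta <= pi & mdot u v = 2 * cos theta].

Definition divergent u v : Prop := 2 < `|mdot u v|.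

Definition coxeter_polytope_with (N P : set 'rV[R]_n.+1) : Prop :=
  polytope_with N P /\
  forall u v, N u -> N v -> u <> v ->
    [\/ has_angle u v 0,
        exists2 m : nat, (0 < m)%N & has_angle u v (pi / m%:R)
      | divergent u v].

Definition coxeter_simplex (P : set 'rV[R]_n.+1) : Prop :=
  exists N, simplex_with N P /\ coxeter_polytope_with N P.

End Hyperbolic.

(* [inord k : 'I_10] is the index k, so [x 0 (inord k)] is x_k. *)
Definition P9 (R : realType) : set 'rV[R]_10 :=
  [set x | [/\ @hyp R 9 x,
    x 0 (inord 0) >= - x 0 (inord 1) - x 0 (inord 2) - x 0 (inord 3),
    forall i : nat, (1 <= i < 9)%N -> x 0 (inord i) <= x 0 (inord i.+1)
    & x 0 (inord 9) <= 0]].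

(* Main.v *)
Require Import Defs.
From mathcomp Require Import all_boot all_order all_algebra.
From mathcomp Require Import all_classical all_reals all_analysis.
From mathcomp Require Import ring lra.

(** The ten inequalities are [0 <= x . u_k] for explicit vectors [u_0, ..., u_9]
    of square -2 ([wall]), where [u_9] needs the factor [sqrt 2]. Their Gram
    matrix ([wall_gram]) has off-diagonal entries 0, 1 and [sqrt 2], so the
    dihedral angles are [pi/2], [pi/3] and [pi/4]; the Coxeter diagram is the
    chain [u_1 - ... - u_8 = u_9], whose last bond is double, with [u_0]
    attached to [u_3].

    The ten vectors are linearly independent. The dual basis, up to positive
    factors, consists of the rays [vertex k], and any [x] is the combination of
    the [vertex k] whose coefficients are the left-hand sides of the ten
    inequalities ([vertex_decomposition]). Hence the solutions in R^(1,9) form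
    the convex cone generated by the [vertex k] ([conic_vertexE]). Writing
    [a_i = - x_i], so that [a_1 >= ... >= a_9 >= 0] and
    [x_0 >= a_1 + a_2 + a_3], one finds
    [x_0^2 >= a_1^2 + a_2^2 + a_3^2 + 6 a_3^2 >= a_1^2 + ... + a_9^2],
    so this cone lies in the light cone ([chamber_causal]). The three
    double products [2 a_i a_j] with [i < j <= 3] are each at least [2 a_3^2],
    which pays exactly for the six squares [a_4^2, ..., a_9^2]; in dimension 9
    the cone therefore just touches the light cone.

    Finite volume then holds for any finitely generated closed cone inside the
    future light cone that contains [e0] ([finite_volume_conic]): its image in
    the projectivized light cone is closed, is the convex hull of the images of
    the generators, and is approximated by points of H^n, because adding a small
    multiple of [e0] makes a vector of the cone timelike. *)

Set Implicit Arguments.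
Unset Strict Implicit.
Unset Printing Implicit Defensive.
Import Order.TTheory GRing.Theory Num.Theory.
Import numFieldNormedType.Exports.
Local Open Scope classical_set_scope.
Local Open Scope ring_scope.
Local Open Scope quotient_scope.

(** * The Lorentzian form *)

Section LorentzForm.
Variables (R : realType) (n : nat).
Implicit Types (u v w : 'rV[R]_n.+1) (c : R).

Lemma mdotC u v : mdot u v = mdot v u.
Proof.
by rewrite /mdot mulrC; congr (_ - _); apply: eq_bigr => i _; rewrite mulrC.
Qed.

Lemma mdotDl u v w : mdot (u + v) w = mdot u w + mdot v w.
Proof.
rewrite /mdot mxE mulrDl addrACA -opprD -big_split/=; congr (_ - _).
by apply: eq_bigr => i _; rewrite mxE mulrDl.
Qed.

Lemma mdotZl c u v : mdot (c *: u) v = c * mdot u v.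
Proof.
rewrite /mdot mxE mulrBr mulr_sumr mulrA; congr (_ - _).
by apply: eq_bigr => i _; rewrite mxE mulrA.
Qed.

Lemma mdotDr u v w : mdot u (v + w) = mdot u v + mdot u w.
Proof. by rewrite mdotC mdotDl !(mdotC _ u). Qed.

Lemma mdotZr c u v : mdot u (c *: v) = c * mdot u v.
Proof. by rewrite mdotC mdotZl mdotC. Qed.

Lemma mdot_e0 v : mdot v (e0 R n) = v 0 ord0.
Proof.
rewrite /mdot !mxE !eqxx mulr1 big1 ?subr0// => i _.
by rewrite mxE /= mulr0.
Qed.

Lemma mdot_e0e0 : mdot (e0 R n) (e0 R n) = 1.
Proof. by rewrite mdot_e0 mxE !eqxx. Qed.

Lemma mdot_continuous u : continuous (fun v => mdot v u).
Proof.
move=> v; rewrite /mdot.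
have cM (i : 'I_n.+1) :
    (fun x : 'rV[R]_n.+1 => x 0 i * u 0 i) x @[x --> v] --> v 0 i * u 0 i.
  by apply: (@cvgM R _ (nbhs v)); [exact: coord_continuous|exact: cvg_cst].
apply: (@cvgB R R^o _ (nbhs v)) => //.
by apply: cvg_big => [x|i _]; [exact: add_continuous|exact: cM].
Qed.

End LorentzForm.

(** * Points of the projectivized light cone and their representatives *)

Section ProjectivePoints.
Variables (R : realType) (n : nat).
Implicit Types (v w : 'rV[R]_n.+1) (p q : hbar R n).

Lemma rep_exists v : cone v -> v != 0 -> exists p, rep v p.
Proof.
move=> cv v0.
have nv : v \in @nzcone R n by rewrite inE; split => //; exact/eqP.
by exists (\pi_(hbar R n) (exist _ v nv)), (exist _ v nv).
Qed.

Lemma rep_neq0 v p : rep v p -> v != 0.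
Proof. by move=> [x [<- _]]; have /set_mem[_ /eqP] := valP x. Qed.

Lemma rep_cone v p : rep v p -> cone v.
Proof. by move=> [x [<- _]]; have /set_mem[] := valP x. Qed.

Lemma rep_pi (x : set_type (@nzcone R n)) v :
  rep v (\pi_(hbar R n) x) -> exists2 c : R, c != 0 & v = c *: \val x.
Proof.
by move=> [y [<-]] /eqP; rewrite eq_sym => /eqP/eqmodP/asboolP.
Qed.

Lemma rep_proportional v w p :
  rep v p -> rep w p -> exists2 c : R, c != 0 & w = c *: v.
Proof. by move=> [x [<- <-]] /rep_pi. Qed.

Lemma rep_scale v (c : R) p : c != 0 -> rep v p -> rep (c *: v) p.
Proof.
move=> c0 rv; have [x [xv xp]] := rv.
have cv : c *: v \in @nzcone R n.
  rewrite inE; split; last first.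
    by apply/eqP; rewrite scaler_eq0 negb_or c0 (rep_neq0 rv).
  rewrite /cone/= mdotZl mdotZr mulrA.
  by rewrite mulr_ge0 ?(rep_cone rv)// -expr2 sqr_ge0.
exists (exist _ (c *: v) cv); split => //.
by rewrite -xp; apply/esym/eqmodP/asboolP; exists c; rewrite //= xv.
Qed.

Lemma rep_inj v p q : rep v p -> rep v q -> p = q.
Proof.
move=> [x [xv <-]] [y [yv <-]]; congr (\pi _).
by apply: val_inj; rewrite xv yv.
Qed.

End ProjectivePoints.

(** * Finitely generated cones have finite volume *)

Section Conic.
Variables (R : realType) (n m : nat) (w : 'I_m -> 'rV[R]_n.+1).
Implicit Types (u v : 'rV[R]_n.+1).

Definition conic : set 'rV[R]_n.+1 :=
  [set v | exists2 c : 'I_m -> R, forall i, 0 <= c i & v = \sum_i c i *: w i].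

Lemma conicD u v : conic u -> conic v -> conic (u + v).
Proof.
move=> [c c0 ->] [d d0 ->]; exists (fun i => c i + d i).
  by move=> i; rewrite addr_ge0.
by rewrite -big_split; apply: eq_bigr => i _; rewrite scalerDl.
Qed.

Lemma conicZ (a : R) v : 0 <= a -> conic v -> conic (a *: v).
Proof.
move=> a0 [c c0 ->]; exists (fun i => a * c i).
  by move=> i; rewrite mulr_ge0.
by rewrite scaler_sumr; apply: eq_bigr => i _; rewrite scalerA.
Qed.

Lemma conic_gen i : conic (w i).
Proof.
exists (fun j => (j == i)%:R) => [j|]; first exact: ler0n.
rewrite (bigD1 i)//= eqxx scale1r big1 ?addr0// => j /negPf ->.
by rewrite scale0r.
Qed.

Lemma conic_ind (K : set 'rV[R]_n.+1) : K 0 ->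
  (forall i, K (w i)) -> (forall u v, K u -> K v -> K (u + v)) ->
  (forall (a : R) v, 0 <= a -> K v -> K (a *: v)) -> conic `<=` K.
Proof.
move=> K0 Kw KD KZ v [c c0 ->]; apply: (big_ind K) => // i _.
exact: KZ.
Qed.

End Conic.

Section ProjectiveCone.
Variables (R : realType) (n m : nat) (w : 'I_m -> 'rV[R]_n.+1).
Implicit Types (u v : 'rV[R]_n.+1) (p q : hbar R n).
Hypothesis w_neq0 : forall i, w i != 0.
Hypothesis w_closed : closed (conic w).
Hypothesis w_cone : conic w `<=` @cone R n.
Hypothesis w_future : forall v, conic w v -> v != 0 -> 0 < mdot v (e0 R n).
Hypothesis w_e0 : conic w (e0 R n).

Definition proj_conic : set (hbar R n) := to_hbar (conic w).

(** A point of [hbar] has both future and past representatives; only the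
    future ones can be expected in the cone, and all of them are there. *)
Lemma rep_proj_conic v p :
  proj_conic p -> rep v p -> 0 < mdot v (e0 R n) -> conic w v.
Proof.
move=> [u cu ru] rv v0; have [c _ vE] := rep_proportional ru rv.
have u0 := w_future cu (rep_neq0 ru).
rewrite vE; apply: conicZ => //; apply: ltW.
by move: v0; rewrite vE mdotZl pmulr_lgt0.
Qed.

(** The preimage in the light cone is the union of the cone and its opposite. *)
Lemma proj_conic_closed : closed proj_conic.
Proof.
rewrite -[proj_conic]setCK; apply: open_closedC.
rewrite /open/= /quotient_open preimage_setC; apply: closed_openC.
rewrite [X in closed X](_ : _ =
  set_val @^-1` (conic w `|` -%R @^-1` conic w)).
  apply: preimage_closed => [x _|]; first exact: initial_continuous.
  apply: closedU => //; apply: preimage_closed => // x _.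
  exact: opp_continuous.
apply/seteqP; split => x /=.
- move=> [v cv /rep_pi[c c0 vE]].
  have xE : set_val x = c^-1 *: v.
    by rewrite set_valE vE scalerA mulVf// scale1r.
  case: (ltP 0 c) => c1.
    by left; rewrite xE; apply: conicZ; rewrite ?invr_ge0 ?ltW.
  by right; rewrite xE -scaleNr; apply: conicZ; rewrite // oppr_ge0 invr_le0.
- have rx : rep (\val x) (\pi_(hbar R n) x) by exists x.
  rewrite set_valE => -[] cx; [by exists (\val x)|exists (- \val x) => //].
  by rewrite -scaleN1r; apply: rep_scale; rewrite ?oppr_eq0 ?oner_eq0.
Qed.

Lemma proj_conic_convex : hbar_convex proj_conic.
Proof.
move=> p q r u v t Cp Cq ru rv u0 v0 /andP[t0 t1] rr.
exists (t *: u + (1 - t) *: v) => //.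
apply: conicD; apply: conicZ; rewrite ?subr_ge0//.
- exact: rep_proj_conic ru u0.
- exact: rep_proj_conic rv v0.
Qed.

(** For a convex set [C] of projective points, the vectors of the cone whose
    class lies in [C] are closed under sums: [u + v] represents the midpoint of
    the segment between the representatives [2 u] and [2 v]. *)
Lemma proj_conic_sub_hull (S : set (hbar R n)) :
  (forall i p, rep (w i) p -> S p) -> proj_conic `<=` hbar_hull S.
Proof.
move=> Sw p [v cv rv] C [/= Cconv SC].
(* The zero vector represents no point, so it satisfies the last condition. *)
suff: conic w `<=` [set v | conic w v /\ forall p, rep v p -> C p].
  by move=> /(_ v cv)[_]; exact.
move=> {p v cv rv}; apply: conic_ind.
- split=> [|p /rep_neq0/eqP//].
  by exists (fun=> 0) => //; rewrite big1 // => i _; rewrite scale0r.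
- by move=> i; split=> [|p rp]; [exact: conic_gen|exact/SC/(Sw i)].
- move=> u v [cu Cu] [cv Cv]; split=> [|r rr]; first exact: conicD.
  have [u0|u0] := eqVneq u 0; first by apply: Cv; rewrite u0 add0r in rr.
  have [v0|v0] := eqVneq v 0; first by apply: Cu; rewrite v0 addr0 in rr.
  have [p rp] := rep_exists (w_cone cu) u0.
  have [q rq] := rep_exists (w_cone cv) v0.
  (* [u] and [v] serve as well as [2 u] and [2 v], since [(u + v) / 2] and
     [u + v] represent the same point. *)
  apply: (Cconv p q r u v 2^-1); [exact: Cu|exact: Cv|by []|by []|..].
  + exact: w_future.
  + exact: w_future.
  + by apply/andP; split; lra.
  + have -> : (1 - 2^-1 : R) = 2^-1 by lra.
    by rewrite -scalerDr; apply: rep_scale => //; lra.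
- move=> a v a0 [cv Cv]; split=> [|p rp]; first exact: conicZ.
  have a1 : a != 0.
    by apply: contra_neq (rep_neq0 rp) => ->; rewrite scale0r.
  apply: Cv; have := rep_scale (invr_neq0 a1) rp.
  by rewrite scalerA mulVf// scale1r.
Qed.

(** Ideal points are limits of points of [hyp]: for [v] in the cone and [t > 0]
    the vector [v + t e0] stays in the cone and has square
    [v . v + 2 t v_0 + t^2 > 0], so a multiple of it lies in [hyp]. *)
Lemma proj_conic_sub_closure :
  proj_conic `<=` closure (to_hbar (@hyp R n `&` conic w)).
Proof.
move=> p [v cv rv] B.
rewrite nbhsE => -[U [oU Up] UB].
suff [q] : to_hbar (@hyp R n `&` conic w) `&` U !=set0.
  by move=> [Hq /UB Bq]; exists q.
have [x [xv xp]] := rv.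
(* Open sets of [hbar] pull back to traces of open sets of the ambient space. *)
have [V oV VE] :
  wopen (@set_val _ (@nzcone R n)) (\pi_(hbar R n) @^-1` U) := oU.
have Vv : V v.
  suff : (set_val @^-1` V) x by rewrite /= set_valE xv.
  by rewrite VE /= xp.
have v0 := w_future cv (rep_neq0 rv).
have vv := w_cone cv; rewrite /cone/= in vv.
pose f (t : R) := v + t *: e0 R n.
have cf : {for 0, continuous f}.
  apply: (@cvgD _ _ _ _ _ _ _ _ _ (cvg_cst v)).
  exact: scalel_continuous.
have [e /= e_gt0 fV] : \forall t \near (0:R), V (f t).
  by apply: cf; rewrite /f scale0r addr0; exact: open_nbhs_nbhs.
pose t := e / 2.
have t0 : 0 < t by rewrite divr_gt0.
have Vt : V (f t).
  by apply: fV; rewrite /= sub0r normrN gtr0_norm// /t; lra.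
have ct : conic w (f t).
  by apply: conicD => //; apply: conicZ => //; exact: ltW.
have ft : 0 < mdot (f t) (f t).
  rewrite /f mdotDl !mdotDr !mdotZl !mdotZr mdot_e0e0 (mdotC _ v) mulr1.
  by have := mulr_gt0 t0 v0; have := mulr_gt0 t0 t0; lra.
have ft0 : 0 < mdot (f t) (e0 R n).
  by rewrite /f mdotDl mdotZl mdot_e0e0 mulr1 addr_gt0.
have fn0 : f t != 0.
  apply: contraTneq ft => ->.
  by rewrite -(scale0r (0 : 'rV[R]_n.+1)) mdotZl mul0r ltxx.
have [q rq] := rep_exists (ltW ft : cone (f t)) fn0.
exists q; split; last first.
  have [y [yf <-]] := rq.
  suff : (set_val @^-1` V) y by rewrite VE.
  by rewrite /= set_valE yf.
pose s := (Num.sqrt (mdot (f t) (f t)))^-1.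
have s0 : 0 < s by rewrite invr_gt0 sqrtr_gt0.
exists (s *: f t); last by apply: rep_scale => //; rewrite gt_eqF.
split; last exact: conicZ (ltW s0) ct.
split; last by rewrite mdotZl mulr_gt0.
rewrite mdotZl mdotZr mulrA /s -invfM -expr2 sqr_sqrtr ?ltW//.
by rewrite mulVf// gt_eqF.
Qed.

Lemma finite_volume_conic : finite_volume (@hyp R n `&` conic w).
Proof.
have gp i : exists p, rep (w i) p.
  by apply: rep_exists; [exact/w_cone/conic_gen|].
have [p_ pP] := choice gp.
exists (range p_); first exact: finite_image.
apply/seteqP; split.
- apply: (@subset_trans _ proj_conic); last first.
    apply: proj_conic_sub_hull => i p rp.
    by exists i => //; exact: rep_inj (pP i) rp.
  rewrite [X in _ `<=` X](closure_id proj_conic).1.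
    by apply: closure_subset => p [v [_ cv] rv]; exists v.
  exact: proj_conic_closed.
- apply: subset_trans proj_conic_sub_closure => p; apply; split.
    exact: proj_conic_convex.
  by move=> _ [i _ <-]; exists (w i); [exact: conic_gen|].
Qed.

End ProjectiveCone.

(** * Angles *)

Section Angles.
Variable R : realType.

Lemma cos_pi4 : cos (pi / 4%:R) = Num.sqrt 2 / 2 :> R.
Proof.
have pi0 := pi_gt0 R.
have c0 : 0 < cos (pi / 4%:R) :> R.
  by apply: cos_gt0_pihalf; apply/andP; split; lra.
have : cos ((pi / 4%:R) *+ 2) = 0 :> R.
  by rewrite (_ : _ *+ 2 = pi / 2) ?cos_pihalf// -mulr_natr; field.
rewrite cos_mulr2n => c2.
apply: (@pexpIrn R 2); rewrite ?nnegrE ?ltW// ?divr_ge0 ?sqrtr_ge0//.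
by rewrite expr_div_n sqr_sqrtr//; lra.
Qed.

(** With [c] the cosine, [cos (2 pi / 3) = - c] makes [c] a root of
    [2 c^2 + c - 1 = (2 c - 1) (c + 1)]. *)
Lemma cos_pi3 : cos (pi / 3%:R) = 1 / 2 :> R.
Proof.
have pi0 := pi_gt0 R.
have c0 : 0 < cos (pi / 3%:R) :> R.
  by apply: cos_gt0_pihalf; apply/andP; split; lra.
have : cos ((pi / 3%:R) *+ 2) = - cos (pi / 3%:R) :> R.
  rewrite (_ : _ *+ 2 = - (pi / 3%:R) + pi) ?cosDpi ?cosN//.
  by rewrite -mulr_natr; field.
rewrite cos_mulr2n => c2.
have /eqP : (2 * cos (pi / 3%:R) - 1) * (cos (pi / 3%:R) + 1) = 0 :> R by lra.
by rewrite mulf_eq0 => /orP[] /eqP; lra.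
Qed.

Lemma has_angle_sym n (u v : 'rV[R]_n.+1) t : has_angle u v t -> has_angle v u t.
Proof. by case=> uv t0 uvE; split; rewrite // mdotC. Qed.

Lemma has_angle_pi_div n (u v : 'rV[R]_n.+1) m : (0 < m)%N ->
  mdot u v = 2 * cos (pi / m%:R) -> has_angle u v (pi / m%:R).
Proof.
move=> m0 uv; have pi0 := pi_gt0 R; split => //.
  by rewrite uv normrM gtr0_norm// ger_pMr// ler_norml cos_geN1 cos_le1.
apply/andP; split; first by rewrite divr_ge0 // ltW.
by rewrite ler_pdivrMr ?ltr0n// ler_peMr ?ler1n// ltW.
Qed.

End Angles.

(** * The walls and vertices in dimension nine *)

Local Notation "x '_[' k ]" := (x ord0 (inord k : 'I_10))
  (at level 2, format "x '_[' k ]").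

Section Chamber.
Variable R : realType.
Implicit Types (x y : 'rV[R]_10) (k : nat).

Lemma mdot10 x y : mdot x y = x _[0] * y _[0] -
  (x _[1] * y _[1] + x _[2] * y _[2] + x _[3] * y _[3] + x _[4] * y _[4]
  + x _[5] * y _[5] + x _[6] * y _[6] + x _[7] * y _[7] + x _[8] * y _[8]
  + x _[9] * y _[9]).
Proof.
rewrite /mdot !big_ord_recl big_ord0 addr0 !addrA.
by congr (_ - _); do 8?congr (_ + _); congr (x _ _ * y _ _); apply: val_inj;
  rewrite /= inordK.
Qed.

(** [u_0 = e_0 - e_1 - e_2 - e_3], [u_k = e_k - e_(k+1)] for [1 <= k <= 8], and
    [u_9 = sqrt 2 e_9]: for [k = 9] no column has index [k + 1]. *)
Definition wall k : 'rV[R]_10 := \row_(j < 10)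
  if k == 0%N then (j == 0%N :> nat)%:R - (0 < j <= 3)%N%:R
  else (if k == 9 then Num.sqrt 2 else 1) *
       ((j == k :> nat)%:R - (j == k.+1 :> nat)%:R).

(** Without the factor [sqrt 2] of [wall]; with [x_10 = 0] the last form follows
    the pattern of those for [1 <= k <= 8]. *)
Definition wall_form k x : R :=
  if k == 0%N then x _[0] + x _[1] + x _[2] + x _[3]
  else (if k == 9 then 0 else x _[k.+1]) - x _[k].

Definition chamber : set 'rV[R]_10 :=
  [set x | forall k, (k < 10)%N -> 0 <= wall_form k x].

Lemma mdot_wall x k : (k < 10)%N ->
  mdot x (wall k) = (if k == 9 then Num.sqrt 2 else 1) * wall_form k x.
Proof.
rewrite mdot10 !mxE !inordK// /wall_form.
by do 10?[case: k => [|k] /=; first by move=> _; ring].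
Qed.

Lemma mdot_wall_ge0 x k :
  (k < 10)%N -> (0 <= mdot x (wall k)) = (0 <= wall_form k x).
Proof.
move=> k10; rewrite mdot_wall// pmulr_rge0//.
by case: ifP; rewrite ?sqrtr_gt0.
Qed.

Lemma wall_formD k x y : wall_form k (x + y) = wall_form k x + wall_form k y.
Proof. by rewrite /wall_form !mxE; case: (k == 0%N) (k == 9) => [] []; ring. Qed.

Lemma wall_formZ k (a : R) x : wall_form k (a *: x) = a * wall_form k x.
Proof. by rewrite /wall_form !mxE; case: (k == 0%N) (k == 9) => [] []; ring. Qed.

Lemma wall_sq k : (k < 10)%N -> mdot (wall k) (wall k) = -2.
Proof.
move=> k10; rewrite mdot_wall// /wall_form !mxE.
have s2 : Num.sqrt 2 * Num.sqrt 2 = 2 :> R by rewrite -expr2 sqr_sqrtr.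
move: k10.
do 10?[case: k => [|k] /=; first by move=> _; rewrite !inordK//=; lra].
by [].
Qed.

(** The Coxeter diagram: the outer condition lists its bonds, and the inner one
    singles out the double bond between [u_8] and [u_9]. *)
Lemma wall_gram i j : (i < j < 10)%N -> mdot (wall i) (wall j) =
  if (if i == 0 then j == 3 else j == i.+1)%N
  then (if j == 9 then Num.sqrt 2 else 1) else 0.
Proof.
case/andP=> ij j10; rewrite mdot_wall// /wall_form !mxE.
move: ij j10; do 10?[case: j => [|j] /=; first by
  rewrite !inordK//; do 9?[case: i => [|i] /=; first by move=> _ _; ring]].
by [].
Qed.

(** The dual basis of the forms: [e_0] for [k = 0], and
    [min(k, 3) e_0 - e_1 - ... - e_k] for [k >= 1]. The squares are 1, 0, 2 and
    [9 - k] for [k >= 3], so that the vertices 1 and 9 are ideal. *)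
Definition vertex k : 'rV[R]_10 := \row_(j < 10)
  if j == 0%N :> nat
  then (if k == 0%N then 1 else if (k < 3)%N then k%:R else 3)
  else - (j <= k)%N%:R.

Lemma vertex_decomposition x : x = \sum_(k < 10) wall_form k x *: vertex k.
Proof.
apply/rowP => j.
rewrite summxE !big_ord_recl big_ord0 /= !mxE /= /bump /= !add1n /wall_form /=.
have -> : j = inord j by apply: val_inj; rewrite /= inordK.
case: j => j /=.
do 10?[case: j => [|j] /=; first by move=> _; rewrite ?inordK//=; ring].
by [].
Qed.

Lemma wall_form_vertex_ge0 i k :
  (i < 10)%N -> (k < 10)%N -> 0 <= wall_form i (vertex k).
Proof.
move=> i10 k10; rewrite /wall_form !mxE.
move: i10 k10; do 10?[case: i => [|i] /=; first by
  rewrite !inordK//; do 10?[case: k => [|k] /=; first by move=> _ _; lra]].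
by [].
Qed.

Lemma conic_vertexE : conic (fun k : 'I_10 => vertex k) = chamber.
Proof.
apply/seteqP; split; last first.
  move=> x xl; exists (fun k : 'I_10 => wall_form k x) => [k|]; first exact: xl.
  exact: vertex_decomposition.
apply: conic_ind.
- by move=> k _; rewrite -(scale0r (0 : 'rV[R]_10)) wall_formZ mul0r.
- by move=> i k k10; apply: wall_form_vertex_ge0.
- by move=> u v ul vl k k10; rewrite wall_formD addr_ge0 ?ul ?vl.
- by move=> a v a0 vl k k10; rewrite wall_formZ mulr_ge0 ?vl.
Qed.

Lemma chamber_coords x : chamber x ->
  [/\ x _[0] >= - x _[1] - x _[2] - x _[3],
   forall i : nat, (1 <= i < 9)%N -> x _[i] <= x _[i.+1] & x _[9] <= 0].
Proof.
move=> xl; split.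
- by have := xl 0 isT; rewrite /wall_form/=; lra.
- case=> // i /andP[_ i9]; have := xl i.+1 (leqW i9).
  by rewrite /wall_form /= (ltn_eqF i9); lra.
- by have := xl 9 isT; rewrite /wall_form/=; lra.
Qed.

Lemma P9E : @P9 R = @hyp R 9 `&` chamber.
Proof.
apply/seteqP; split => x; last first.
  by move=> [hx /chamber_coords[]]; split.
move=> [hx x0 xi x9]; split => // -[_|k]; first by rewrite /wall_form/=; lra.
rewrite ltnS leq_eqVlt => /orP[/eqP[->]|k9]; first by rewrite /wall_form/=; lra.
by have := xi k.+1; rewrite /wall_form /= k9 (ltn_eqF k9) => /(_ isT); lra.
Qed.

(** [x_0^2] is at least the square of [x_1 + x_2 + x_3], whose double products
    amount to at least [6 x_3^2] and so bound the squares of the six coordinates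
    after [x_3]. *)
Lemma chamber_causal x : chamber x ->
  0 <= mdot x x /\ (x != 0 -> 0 < x _[0]).
Proof.
move=> /chamber_coords[x0 xi x9].
have x1 := xi 1 isT; have x2 := xi 2 isT; have x3 := xi 3 isT.
have x4 := xi 4 isT; have x5 := xi 5 isT; have x6 := xi 6 isT.
have x7 := xi 7 isT; have x8 := xi 8 isT.
split.
  have sq (a b c : R) : a <= b -> b <= c -> c <= 0 -> c * c <= a * b.
    by move=> *; nra.
  have h12 : x _[3] * x _[3] <= x _[1] * x _[2] by apply: sq; lra.
  have h13 : x _[3] * x _[3] <= x _[1] * x _[3] by apply: sq; lra.
  have h23 : x _[3] * x _[3] <= x _[2] * x _[3] by apply: sq; lra.
  have h k : x _[3] <= x _[k] -> x _[k] <= 0 ->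
      x _[k] * x _[k] <= x _[3] * x _[3].
    by move=> *; apply: sq; lra.
  have h0 : (- x _[1] - x _[2] - x _[3]) * (- x _[1] - x _[2] - x _[3]) <=
      x _[0] * x _[0].
    by rewrite ler_pM//; lra.
  rewrite mdot10; rewrite subr_ge0; apply: le_trans h0.
  have := h 4; have := h 5; have := h 6; have := h 7; have := h 8; have := h 9.
  by do 6?[move=> /(_ ltac:(lra) ltac:(lra)) ?]; lra.
move=> xn; rewrite lt_neqAle eq_sym; apply/andP; split; last by lra.
(* If [x_0 = 0], the inequalities squeeze every coordinate to 0. *)
apply: contra_neq xn => x00; apply/rowP => j; rewrite mxE.
have -> : j = inord j by apply: val_inj; rewrite /= inordK.
case: j => j /=.
do 10?[case: j => [|j] /=; first by move=> _; lra].
by [].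
Qed.

End Chamber.

(** * The Coxeter simplex *)

Section CoxeterSimplex.
Variable R : realType.
Implicit Types (x : 'rV[R]_10) (k : nat).

Local Notation wall := (@wall R).
Local Notation vertex := (@vertex R).

Definition walls : set 'rV[R]_10 := wall @` `I_10.

Lemma halfspaces_inter_walls :
  halfspaces_inter walls = @hyp R 9 `&` @chamber R.
Proof.
apply/seteqP; split => x [hx xw]; split => //.
  by move=> k k10; rewrite -mdot_wall_ge0//; apply: (xw _ _).2; exists k.
by move=> _ [k k10 <-]; split => //; rewrite mdot_wall_ge0//; exact: xw.
Qed.

(** A point of [hyp] that violates the [k]-th inequality only: for [k >= 1] the
    first [k] spatial coordinates are raised to 1, which breaks only
    [x_k <= x_(k+1)] (with [x_10 = 0]), and [x_0] is determined by the norm. *)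
Definition outside k : 'rV[R]_10 := \row_(j < 10)
  if k == 0%N then (if j == 0%N :> nat then 2 else - (j <= 3)%N%:R)
  else (if j == 0%N :> nat then Num.sqrt k.+1%:R else (j <= k)%N%:R).

Lemma outside_hyp k : (k < 10)%N -> @hyp R 9 (outside k).
Proof.
move=> k10; split; last first.
  by rewrite mdot_e0 mxE /=; case: ifP => // _; rewrite sqrtr_gt0.
rewrite mdot10 !mxE !inordK//=.
have sq m : Num.sqrt m%:R * Num.sqrt m%:R = m%:R :> R.
  by rewrite -expr2 sqr_sqrtr.
move: k10; do 10?[case: k => [|k] /=; first by move=> _; rewrite ?sq; lra].
by [].
Qed.

Lemma wall_form_outside i k : (i < 10)%N -> (k < 10)%N ->
  if i == k then wall_form i (outside k) < 0 else 0 <= wall_form i (outside k).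
Proof.
move=> i10 k10; rewrite /wall_form !mxE.
have := sqrtr_ge0 (k.+1%:R : R); move: i10 k10.
do 10?[case: i => [|i] /=; first by
  rewrite !inordK//; do 10?[case: k => [|k] /=; first by move=> _ _ ?; lra]].
by [].
Qed.

Lemma walls_minimal : minimal walls.
Proof.
move=> _ [k k10 <-] /(_ (outside k)) []; last first.
  rewrite mdot_wall_ge0// leNgt.
  by have := wall_form_outside k10 k10; rewrite eqxx => ->.
split=> [|_ [[i i10 <-] ik]]; first exact: outside_hyp.
split; first exact: outside_hyp.
rewrite mdot_wall_ge0//; have := wall_form_outside i10 k10.
by case: eqP => // ik'; case: ik; rewrite ik'.
Qed.

Lemma wall_gram_ge0 i j : (i < 10)%N -> (j < 10)%N -> i != j ->
  0 <= mdot (wall i) (wall j).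
Proof.
wlog ij : i j / (i < j)%N => [H i10 j10 nij|i10 j10 _].
  case: (ltngtP i j) nij => // ij _; [|rewrite mdotC];
    by apply: H; rewrite ?ltn_eqF.
by rewrite wall_gram ?ij//; case: ifP => // _; case: ifP => // _.
Qed.

Lemma walls_card : (walls #= `I_10)%card.
Proof.
apply: inj_card_eq => i j; rewrite !inE /= => i10 j10 wij.
apply/eqP/negP => /negP nij.
by have := wall_gram_ge0 i10 j10 nij; rewrite wij wall_sq// lerNr oppr0 lern0.
Qed.

Lemma walls_polytope : polytope_with walls (@P9 R).
Proof.
split; last by rewrite halfspaces_inter_walls P9E.
- by move=> _ [k k10 <-]; rewrite wall_sq.
- move=> K _ _; apply: finite_setIl.
  by do 2!apply: finite_image; exact: finite_II.
- exact: walls_minimal.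
Qed.

Lemma P9_finite_volume : finite_volume (@P9 R).
Proof.
rewrite P9E -conic_vertexE; apply: finite_volume_conic.
- move=> k; apply/eqP => /rowP/(_ (inord 0)); rewrite !mxE inordK//=.
  by case: ifP => [_|k0]; [|case: ifP => _]; move/eqP;
    rewrite ?oner_eq0 ?pnatr_eq0 ?k0.
- rewrite conic_vertexE.
  rewrite (_ : @chamber R =
    \bigcap_(k in `I_10) [set x | 0 <= mdot x (wall k)]); last first.
    by apply/seteqP; split=> x xk k k10; have := xk k k10;
      rewrite /= mdot_wall_ge0.
  apply: closed_bigI => k _.
  apply: (@preimage_closed _ _ (fun x => mdot x (wall k)) [set y | 0 <= y]).
    by move=> x _; exact: mdot_continuous.
  exact: closed_ge.
- by rewrite conic_vertexE => v /chamber_causal[].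
- rewrite conic_vertexE => v /chamber_causal[_ H] /H; rewrite mdot_e0.
  by rewrite (_ : inord 0 = ord0) //; apply: val_inj; rewrite /= inordK.
- rewrite (_ : e0 R 9 = vertex (ord0 : 'I_10)); first exact: conic_gen.
  apply/rowP => j; rewrite !mxE /= -val_eqE /=.
  by case: j => -[|j] //= _; rewrite oppr0.
Qed.

Lemma walls_angle i j : (i < j < 10)%N ->
  exists2 m : nat, (0 < m)%N & has_angle (wall i) (wall j) (pi / m%:R).
Proof.
move=> ij; have := wall_gram R ij; case: ifP => _; [case: ifP => _|] => wij.
- by exists 4 => //; apply: has_angle_pi_div => //; rewrite wij cos_pi4; field.
- by exists 3 => //; apply: has_angle_pi_div => //; rewrite wij cos_pi3; field.
- by exists 2 => //; apply: has_angle_pi_div => //; rewrite wij cos_pihalf; ring.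
Qed.

Lemma walls_coxeter : coxeter_polytope_with walls (@P9 R).
Proof.
split=> [|_ _ [i i10 <-] [j j10 <-] wij]; first exact: walls_polytope.
apply: Or32; case: (ltngtP i j) => [ij|ji|ij]; last by rewrite ij in wij.
- by apply: walls_angle; rewrite ij.
- have [|m m0 mP] := @walls_angle j i; first by rewrite ji.
  by exists m => //; exact: has_angle_sym.
Qed.

End CoxeterSimplex.

Theorem theorem1p5 (R : realType) : @coxeter_simplex R 9 (@P9 R).
Proof.
exists (@walls R); split; last exact: walls_coxeter.
by split; [exact: walls_polytope|exact: P9_finite_volume|exact: walls_card].
Qed.
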